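(* There exist absolute constants $C,c>0$ such that the following holds. Let $n\ge1$, $\epsilon\in(0,1]$, and let $f:\{0,1\}^n\to\{-1,1\}$ satisfy $\|f\|_{U_3}\ge\epsilon$. Then there exists a quadratic polynomial function $g$ such that the distance between $f$ and $g$ is at most $\frac12-\epsilon'$, where $\epsilon'\ge c\exp\{-(1/\epsilon)^C\}$.
   Context: $\{0,1\}^n$ is identified with $\mathbb F_2^n$. For $f:\{0,1\}^n\to\mathbb R$ and $d\ge1$, $\|f\|_{U_d}=\big[\mathbb E_{x,y_1,\dots,y_d}\prod_{S\subseteq[d]} f(x+\sum_{i\in S}y_i)\big]^{1/2^d}$ with $x,y_i$ independent uniform. A quadratic polynomial function is a function $g:\{0,1\}^n\to\{-1,1\}$ of the form $g(x)=(-1)^{P(x)}$ where $P$ is an $n$-variate polynomial over $\mathbb F_2$ of degree at most $2$. The distance between two functions $\{0,1\}^n\to\{-1,1\}$ is the fraction of points of $\{0,1\}^n$ at which they differ. *)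

(* Defs.v *)
From HB Require Import structures.
From mathcomp Require Import all_boot all_order all_algebra.
From mathcomp Require Import all_classical all_reals all_analysis.
From mathcomp Require Import Rstruct.
Set Implicit Arguments. Unset Strict Implicit. Unset Printing Implicit Defensive.
Import Order.TTheory GRing.Theory Num.Theory.
Local Open Scope ring_scope.

Notation cube n := 'rV['F_2]_n.

Definition RR := Rdefinitions.R.

Definition avg (T : finType) (F : T -> RR) : RR :=
  (#|{: T}|%:R)^-1 * \sum_(t : T) F t.

Definition gowers_norm (d n : nat) (f : cube n -> RR) : RR :=
  powR (avg (fun x : cube n =>
          avg (fun y : {ffun 'I_d -> cube n} =>
                 \prod_(S : {set 'I_d}) f (x + \sum_(i in S) y i))))
       ((2 ^ d)%:R)^-1.

Definition pm1_valued (n : nat) (f : cube n -> RR) : Prop :=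
  forall x, f x = 1 \/ f x = -1.

Definition quadratic_poly_fun (n : nat) (P : cube n -> 'F_2) : Prop :=
  exists (a0 : 'F_2) (a : 'I_n -> 'F_2) (b : 'I_n -> 'I_n -> 'F_2),
    forall x : cube n,
      P x = a0 + \sum_(i < n) a i * x ord0 i
               + \sum_(i < n) \sum_(j < n) b i j * x ord0 i * x ord0 j.

Definition sign_of (v : 'F_2) : RR := if v == 0 then 1 else -1.

Definition quadratic_polynomial_function (n : nat) (g : cube n -> RR) : Prop :=
  exists P : cube n -> 'F_2, quadratic_poly_fun P /\ forall x, g x = sign_of (P x).

Definition fdist (n : nat) (f g : cube n -> RR) : RR :=
  (#|[set x : cube n | f x != g x]|%:R) / (#|{: cube n}|%:R).

(* Main.v *)
(* Let [amb f (y, a)] be the squared Fourier coefficient at [a] of the derivative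
   [x |-> f x * f (x + y)]. Then [U_3(f)^8] is the mean over [y] of
   [\sum_a amb f (y, a)^2], so the set [S] where [amb f] is at least
   [rho = eps^8 / 2] has about [2^n] points. Since [amb f] is nonnegative and
   equal to its own symplectic Fourier transform, it is positive definite, and
   hence many pairs of points of [S] have their sum in the slightly larger level
   set [S']. The Balog-Szemeredi-Gowers argument yields a large subset of [S] with
   small doubling, and Ruzsa's covering argument puts it in a subspace whose size
   is [2^n] up to a factor exponential in a power of [1 / eps]. This subspace is a
   union of few affine graphs, so [amb f (y, y T + b)] is large on average for some
   matrix [T] and vector [b].

   Writing [y = s + x + z] shows that [T] is symmetric up to a form of small rank,
   so it agrees on a large subspace with an alternating form [M + M^T]. Twisting
   [f] by the quadratic phase of [M] turns [amb f (y, b + y (M + M^T))] into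
   [amb g (y, b)], whose mean over [y] is bounded by the largest squared Fourier
   coefficient of [g]. *)

Require Import Defs.
From HB Require Import structures.
From mathcomp Require Import all_boot all_order all_algebra.
From mathcomp Require Import all_classical all_reals all_analysis.
From mathcomp Require Import Rstruct.
From mathcomp Require Import ring lra.
From mathcomp Require Import zify.
(* Imported again so that [subsetP], [setIidPr], etc. are those of finset and
   not those of classical_sets. *)
From mathcomp Require Import fintype finset.
Set Implicit Arguments. Unset Strict Implicit. Unset Printing Implicit Defensive.
Import Order.TTheory GRing.Theory Num.Theory.
Local Open Scope ring_scope.

(** * Sumsets *)

Definition sumset (G : finZmodType) (A B : {set G}) : {set G} :=
  [set a + b | a in A, b in B].

Lemma mem_sumset (G : finZmodType) (A B : {set G}) (a b : G) :
  a \in A -> b \in B -> a + b \in sumset A B.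
Proof. by move=> aA bB; apply/imset2P; exists a b. Qed.

Lemma sumsetA (G : finZmodType) (A B C : {set G}) :
  sumset A (sumset B C) = sumset (sumset A B) C.
Proof.
apply/setP=> x; apply/imset2P/imset2P.
  by case=> a _ aA /imset2P[b c bB cC ->] ->; exists (a + b) c;
    rewrite ?mem_sumset ?addrA.
by case=> _ c /imset2P[a b aA bB ->] cC ->; exists a (b + c);
    rewrite ?mem_sumset ?addrA.
Qed.

Lemma sumsetS (G : finZmodType) (A A' B B' : {set G}) :
  A \subset A' -> B \subset B' -> sumset A B \subset sumset A' B'.
Proof.
move=> sA sB; apply/subsetP=> _ /imset2P[a b aA bB ->].
by rewrite mem_sumset // ?(subsetP sA) ?(subsetP sB).
Qed.

Lemma sumset0 (G : finZmodType) (A : {set G}) : sumset A set0 = set0.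
Proof. by apply/eqP/set0Pn=> -[x /imset2P[a b _]]; rewrite inE. Qed.

Lemma card_sumset_le (G : finZmodType) (A B : {set G}) :
  (#|sumset A B| <= #|A| * #|B|)%N.
Proof.
by rewrite -cardsX /sumset curry_imset2X leq_imset_card.
Qed.

(* Petridis: a subset [X] of [A] minimising [|X + A| / |X|] keeps its
   expansion when any further set [C] is added; induction on [C]. *)
Lemma petridis (G : finZmodType) (A X C : {set G}) :
    (forall Z : {set G}, Z \subset X ->
       (#|sumset X A| * #|Z| <= #|sumset Z A| * #|X|)%N) ->
  (#|sumset (sumset X A) C| * #|X| <= #|sumset X A| * #|sumset X C|)%N.
Proof.
move=> minX; have [m] := ubnP #|C|; elim: m C => // m IHm C.
have [->|/set0Pn[c cC]] := eqVneq C set0; first by rewrite !sumset0 cards0.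
rewrite (cardsD1 c) cC add1n ltnS => /IHm; set C0 := C :\ c => IH.
set XA := sumset X A in IH *; set U := sumset XA C0 in IH *.
(* [Z] collects the [x] whose whole translate [x + A + c] already lies in [U], so adding [c] to [XA]
   creates no new points from [Z + A]. *)
pose Z := [set x in X | [forall a in A, x + a + c \in U]].
have ZX : Z \subset X by apply/subsetP=> x; rewrite inE => /andP[].
have ZA : sumset Z A \subset XA by apply: sumsetS.
have shift_inj : injective (fun x : G => x + c) by apply: addIr.
have up : (#|sumset XA C| <= #|U| + (#|XA| - #|sumset Z A|))%N.
  rewrite -(setIidPr ZA) -cardsD -(card_imset (mem (XA :\: _)) shift_inj).
  apply: leq_trans (leq_card_setU _ _); apply/subset_leq_card/subsetP.
  move=> _ /imset2P[y d yXA dC ->]; rewrite inE.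
  have [->|dc] := eqVneq d c; last by rewrite mem_sumset // !inE dc.
  have [|nyZ] := boolP (y \in sumset Z A).
    case/imset2P=> z a; rewrite inE => /andP[_ /forallP /(_ a)] + aA ->.
    by rewrite aA /= => ->.
  by apply/orP; right; apply/imsetP; exists y; rewrite // !inE nyZ.
(* For [x] in [X] outside [Z], the point [x + c] is new: if [x + c = x' + c0], then every
   [x + a + c] equals [x' + a + c0], which is in [U]. *)
have low : (#|sumset X C0| + (#|X| - #|Z|) <= #|sumset X C|)%N.
  rewrite -(setIidPr ZX) -cardsD -(card_imset (mem (X :\: Z)) shift_inj) -cardsUI.
  rewrite [X in (_ + X)%N](_ : _ = 0%N) ?addn0.
    apply/subset_leq_card; rewrite subUset sumsetS ?subD1set //=.
    by apply/subsetP=> _ /imsetP[x /setDP[xX _] ->]; apply: mem_sumset.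
  apply/eqP; rewrite cards_eq0 -subset0; apply/subsetP=> y.
  rewrite inE => /andP[/imset2P[x' c0 x'X c0C ->] /imsetP[x]].
  rewrite !inE => /andP[nxZ xX] e; rewrite xX /= in nxZ.
  case/negP: nxZ; apply/forallP=> a; apply/implyP=> aA.
  by rewrite addrAC -e addrAC mem_sumset // mem_sumset.
have zn := subset_leq_card ZX; have qp := subset_leq_card ZA.
have := minX _ ZX; rewrite -/XA.
move: #|U| #|XA| #|sumset Z A| #|X| #|Z| #|sumset X C0| #|sumset XA C|
  #|sumset X C| IH up low zn qp => u p q k z v t w IH up low zn qp h.
apply: leq_trans (leq_mul up (leqnn k)) _.
apply: leq_trans (leq_mul (leqnn p) low).
rewrite mulnDl mulnDr leq_add // mulnBl mulnBr; lia.
Qed.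

(** [X] minimises [|X + A| / |X|] over the nonempty subsets of [A]; comparison with [A] itself
    bounds the ratio by the doubling of [A]. *)
Lemma plunnecke_petridis (G : finZmodType) (A : {set G}) : A != set0 ->
  exists X : {set G},
    [/\ X != set0, X \subset A,
        (#|sumset X A| * #|A| <= #|sumset A A| * #|X|)%N &
        forall C, (#|sumset (sumset X A) C| * #|X|
                   <= #|sumset X A| * #|sumset X C|)%N].
Proof.
move=> A0; pose P (X : {set G}) := (X != set0) && (X \subset A).
pose r (X : {set G}) : rat := #|sumset X A|%:R / #|X|%:R.
have PA : P A by rewrite /P A0 /=.
have rle (X Z : {set G}) : X != set0 -> Z != set0 -> r X <= r Z ->
    (#|sumset X A| * #|Z| <= #|sumset Z A| * #|X|)%N.
  rewrite -!card_gt0 => X0 Z0.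
  by rewrite ler_pdivrMr ?ltr0n // mulrAC ler_pdivlMr ?ltr0n // -!natrM ler_nat.
have [X /andP[X0 XA] minX] := @Order.TotalTheory.arg_minP _ _ _ A P r PA.
exists X; split=> //; first by apply: rle => //; apply: minX.
move=> C; apply: petridis => Z ZX.
have [->|Z0] := eqVneq Z set0; first by rewrite cards0 muln0.
by apply: rle => //; apply: minX; rewrite /P Z0 (subset_trans ZX).
Qed.

(** [Y] is a largest subset of [T] whose translates [X + y] are pairwise disjoint, a condition
    encoded as [|Y| |X| = |X + Y|]. By maximality each further [X + t] meets [X + Y]. *)
Lemma ruzsa_covering (G : finZmodType) (X T : {set G}) : X != set0 ->
  exists Y : {set G},
    [/\ Y \subset T, (#|Y| * #|X| <= #|sumset X T|)%N &
        forall t, t \in T ->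
          exists y x x', [/\ y \in Y, x \in X, x' \in X & t = y + x - x']].
Proof.
move=> X0; pose P (Y : {set G}) :=
  (Y \subset T) && (#|Y| * #|X| == #|sumset X Y|)%N.
have P0 : P set0 by rewrite /P sub0set cards0 sumset0 cards0.
have [Y /andP[YT /eqP cY] maxY] := @arg_maxnP _ _ P (fun Y => #|Y|) P0.
exists Y; split=> //.
  by rewrite cY; apply/subset_leq_card/sumsetS.
move=> t tT; have [x0 x0X] := set0Pn _ X0.
have [tY|ntY] := boolP (t \in Y).
  by exists t, x0, x0; split; rewrite // addrK.
pose tX := [set x + t | x in X].
have [dis|/pred0Pn[z /andP[/= /imset2P[x' y x'X yY ->]]]] :=
    boolP [disjoint sumset X Y & tX]; last first.
  case/imsetP=> x xX e; exists y, x', x; split=> //.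
  by rewrite [y + _]addrC e addrC addKr.
have /maxY : P (t |: Y); last by rewrite cardsU1 ntY /=; lia.
rewrite /P subUset sub1set tT YT /= cardsU1 ntY mulnDl mul1n cY.
have -> : sumset X (t |: Y) = sumset X Y :|: tX.
  apply/setP=> z; rewrite inE; apply/imset2P/orP.
    case=> x y xX /setU1P[->|yY] ->; last by left; apply: mem_sumset.
    by right; apply/imsetP; exists x.
  case=> [/imset2P[x y xX yY ->]|/imsetP[x xX ->]].
    by exists x y => //; rewrite setU1r.
  by exists x t => //; rewrite setU11.
have ctX : #|tX| = #|X| by apply/card_imset/addIr.
by rewrite cardsU (disjoint_setI0 dis) cards0 subn0 ctX addnC.
Qed.

(* Ruzsa's argument: covering [3A] by translates [y + 2X], [y \in Y], makes
   [<Y> + 2X] stable under adding elements of [A]. *)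
Lemma span_of_small_doubling (R : realFieldType) (G : finZmodType) (A : {set G})
    (K : R) :
    (forall a : G, a + a = 0) -> A != set0 ->
    #|sumset A A|%:R <= K * #|A|%:R ->
  exists (Z : {set G}) (d : nat),
    [/\ 0 \in Z, forall z a, z \in Z -> a \in A -> z + a \in Z,
        d%:R <= K ^+ 3 & #|Z|%:R <= 2 ^+ d * K * #|A|%:R].
Proof.
move=> char2 A0 dbl; have [X [X0 XA minX pet]] := plunnecke_petridis A0.
have oppG (a : G) : - a = a by apply: (addrI a); rewrite subrr char2.
have A_gt0 : 0 < #|A|%:R :> R by rewrite ltr0n card_gt0.
have X_gt0 : 0 < #|X|%:R :> R by rewrite ltr0n card_gt0.
have XA_le : #|sumset X A|%:R <= K * #|X|%:R :> R.
  rewrite -(ler_pM2r A_gt0) -natrM.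
  apply: le_trans (_ : (#|sumset A A| * #|X|)%:R <= _); first by rewrite ler_nat.
  by rewrite natrM mulrAC ler_pM2r.
have K_ge0 : 0 <= K.
  by rewrite -(pmulr_lge0 _ A_gt0); apply: le_trans dbl.
have step C : #|sumset (sumset X A) C|%:R <= K * #|sumset X C|%:R :> R.
  rewrite -(ler_pM2r X_gt0) -natrM.
  apply: le_trans (_ : (#|sumset X A| * #|sumset X C|)%:R <= _).
    by rewrite ler_nat.
  by rewrite natrM mulrAC ler_wpM2r.
pose T := sumset A (sumset A A).
have [Y [YT cY cov]] := ruzsa_covering T X0.
(* Each of the three summands [A] in [T] costs one factor [K]. *)
have cT : #|sumset X T|%:R <= K ^+ 3 * #|X|%:R :> R.
  rewrite /T sumsetA; apply: le_trans (step _) _.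
  rewrite sumsetA exprS -mulrA ler_wpM2l //; apply: le_trans (step _) _.
  by rewrite expr2 -mulrA ler_wpM2l.
have YK : #|Y|%:R <= K ^+ 3.
  by rewrite -(ler_pM2r X_gt0) -natrM; apply: le_trans cT; rewrite ler_nat.
(* In characteristic 2 the subset sums of [Y] form the subgroup it generates. *)
pose sumY (D : {set G}) := \sum_(y in D) y.
pose Z := sumset [set sumY D | D in powerset Y] (sumset X X).
exists Z, #|Y|; split=> //.
- have [x xX] := set0Pn _ X0; rewrite -[0]addr0 -{2}(char2 x).
  apply: mem_sumset; last exact: mem_sumset.
  by apply/imsetP; exists set0; rewrite ?powersetE ?sub0set // /sumY big_set0.
- move=> _ a /imset2P[_ _ /imsetP[D DY ->] /imset2P[x x' xX x'X ->] ->] aA.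
  have /cov[y [u [u' [yY uX u'X e]]]] : x + x' + a \in T.
    rewrite [_ + a]addrC /T !mem_sumset // ?(subsetP XA) //.
  have -> : sumY D + (x + x') + a = sumY D + y + (u + u').
    by rewrite -addrA e oppG !addrA.
  apply: mem_sumset; last exact: mem_sumset.
  apply/imsetP; rewrite powersetE in DY.
  (* Adding [y] to a subset sum toggles the membership of [y] in [D]. *)
  have [yD|nyD] := boolP (y \in D).
    exists (D :\ y); first by rewrite powersetE (subset_trans (subD1set _ _)).
    by rewrite /sumY (big_setD1 y) //= addrAC char2 add0r.
  exists (y |: D); first by rewrite powersetE subUset sub1set yY.
  by rewrite /sumY big_setU1 //= [RHS]addrC.
apply: le_trans (_ : (2 ^ #|Y| * #|sumset X A|)%:R <= _).
  rewrite ler_nat; apply: leq_trans (card_sumset_le _ _) _.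
  rewrite leq_mul //; last by apply/subset_leq_card/sumsetS.
  by rewrite -card_powerset leq_imset_card.
rewrite natrM natrX -mulrA ler_wpM2l ?exprn_ge0 ?ler0n //.
apply: le_trans XA_le _; rewrite ler_wpM2l // ler_nat.
exact: subset_leq_card.
Qed.

(** * Balog-Szemeredi-Gowers *)

Lemma exists_ge_average (R : realFieldType) (T : finType) (S : {set T})
    (phi : T -> R) (m : R) : S != set0 ->
  m * #|S|%:R <= \sum_(x in S) phi x -> exists2 x, x \in S & m <= phi x.
Proof.
move=> S0 le_m; have [x xS] := set0Pn _ S0.
have [/existsP[y /andP[yS hy]]|] := boolP [exists y in S, m <= phi y].
  by exists y.
rewrite negb_exists => /forallP small; exfalso.
have lt_m y : y \in S -> phi y < m.
  by move=> yS; move: (small y); rewrite yS /= -ltNge.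
move: le_m; rewrite leNgt => /negP; apply.
rewrite mulr_natr -sumr_const (bigD1 x) //= [ltRHS](bigD1 x) //=.
rewrite ltr_leD ?lt_m //; apply: ler_sum => y /andP[yS _].
exact/ltW/lt_m.
Qed.

Lemma natr_card (R : pzSemiRingType) (T : finType) (S : {set T}) :
  #|S|%:R = \sum_x (x \in S)%:R :> R.
Proof.
rewrite -sum1_card natr_sum big_mkcond /=.
by apply: eq_bigr => x _; case: (x \in S).
Qed.

Lemma natr_card_set (R : pzSemiRingType) (T : finType) (S : {set T}) (P : pred T) :
  #|[set x in S | P x]|%:R = \sum_(x in S) (P x)%:R :> R.
Proof.
rewrite -sum1_card natr_sum big_mkcond [RHS]big_mkcond /=.
by apply: eq_bigr => x _; rewrite inE; case: (x \in S); case: (P x).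
Qed.

Lemma card_pair_sum (T U : finType) (P : {set T * U}) :
  #|P| = (\sum_(t : T) #|[set u | (t, u) \in P]|)%N.
Proof.
rewrite -sum1_card big_mkcond /=.
under [RHS]eq_bigr => t _ do rewrite -sum1_card big_mkcond /=.
by rewrite pair_bigA; apply: eq_bigr => -[t u] _ /=; rewrite inE.
Qed.

Definition codegree (T : finType) (S : {set T}) (e : rel T) (a b : T) : {set T} :=
  [set c in S | e a c && e c b].

(* Dependent random choice: [A] is the neighbourhood of a suitable vertex. *)
Lemma dependent_choice (R : realFieldType) (T : finType) (S : {set T}) (e : rel T)
    (al : R) : symmetric e -> 0 < al -> S != set0 ->
    al * #|S|%:R ^+ 2 <= \sum_(a in S) \sum_(b in S) (e a b)%:R ->
  exists A : {set T},
    [/\ A \subset S, al ^+ 2 / 2 * #|S|%:R ^+ 2 <= #|A|%:R ^+ 2 :> R &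
        16 * \sum_(a in A) \sum_(b in A)
               (#|codegree S e a b|%:R < al ^+ 2 / 32 * #|S|%:R)%R%:R
          <= #|A|%:R ^+ 2 :> R].
Proof.
move=> sym_e al0 S0 dense.
set tau := al ^+ 2 / 32; set s : R := #|S|%:R in dense *.
pose bad a b := #|codegree S e a b|%:R < tau * s.
pose N c := [set a in S | e a c].
pose B c : R := \sum_(a in N c) \sum_(b in N c) (bad a b)%:R.
have s_gt0 : 0 < s by rewrite ltr0n card_gt0.
have tau_ge0 : 0 <= tau by rewrite /tau !mulr_ge0 ?invr_ge0 ?sqr_ge0 ?(ltW al0).
have degE : \sum_(c in S) #|N c|%:R = \sum_(a in S) \sum_(b in S) (e a b)%:R :> R.
  by rewrite exchange_big /=; apply: eq_bigr => c _; rewrite natr_card_set.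
(* Cauchy-Schwarz, in the form that the squared deviations of the degrees from [al * s] have
   nonnegative sum. *)
have deg2 : al ^+ 2 * s ^+ 3 <= \sum_(c in S) (#|N c|%:R ^+ 2 : R).
  have : 0 <= \sum_(c in S) (#|N c|%:R - al * s) ^+ 2.
    by apply: sumr_ge0 => c _; apply: sqr_ge0.
  under eq_bigr => c _ do rewrite sqrrB -mulrnAr mulrC.
  rewrite big_split sumrB /= -mulr_sumr degE sumr_const -mulr_natr -/s.
  move: dense al0 s_gt0; move: (\sum_(a in S) _) => E; move: (\sum_(a in S) _) => D.
  move=> dense al0 s_gt0 h.
  have : al * s * (al * s ^+ 2) <= al * s * E by rewrite ler_pM2l ?mulr_gt0.
  lra.
(* A bad pair lies in [N c] only for the [c] in its codegree set, that is for fewer than [tau * s]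
   vertices. *)
have sumB : \sum_(c in S) B c <= tau * s ^+ 3.
  have -> : \sum_(c in S) B c =
      \sum_(a in S) \sum_(b in S) (bad a b)%:R * #|codegree S e a b|%:R.
    have sumN c phi : \sum_(a in N c) phi a = \sum_(a in S) (e a c)%:R * phi a :> R.
      rewrite big_mkcond [RHS]big_mkcond /=; apply: eq_bigr => a _; rewrite inE.
      by case: (a \in S); case: (e a c); rewrite ?mul1r ?mul0r.
    rewrite /B; under eq_bigr => c _.
      rewrite sumN; under eq_bigr => a _ do rewrite sumN mulr_sumr; over.
    rewrite exchange_big; apply: eq_bigr => a _ /=.
    rewrite exchange_big; apply: eq_bigr => b _ /=.
    rewrite natr_card_set mulr_sumr; apply: eq_bigr => c _.
    by rewrite (sym_e c b) -mulnb natrM; case: (e a c); case: (e b c); case: (bad a b);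
       rewrite ?(mulr0, mul0r, mulr1, mul1r).
  have -> : tau * s ^+ 3 = \sum_(a in S) \sum_(b in S) tau * s.
    rewrite !sumr_const -mulr_natr -(mulr_natr (tau * s)) -/s; ring.
  apply: ler_sum => a _; apply: ler_sum => b _.
  rewrite /bad; case: ltP => [/ltW le_cd|_]; first by rewrite mul1r.
  by rewrite mul0r mulr_ge0 ?(ltW s_gt0).
(* The value [al ^ 2 / 32] of [tau] makes the subtracted term at most half of the main one. A single
   [c] then gives both a large [N c] and few bad pairs in it. *)
have [] := @exists_ge_average R T S (fun c => #|N c|%:R ^+ 2 - 16 * B c)
             (al ^+ 2 / 2 * s ^+ 2) S0.
  rewrite sumrB -mulr_sumr -/s; rewrite /tau in sumB; lra.
move=> c cS hc; exists (N c); split.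
- by apply/subsetP=> a; rewrite inE => /andP[].
- have : 0 <= B c by apply: sumr_ge0 => a _; apply: sumr_ge0 => b _; apply: ler0n.
  move: hc; lra.
- have : 0 <= al ^+ 2 / 2 * s ^+ 2.
    by rewrite !mulr_ge0 ?invr_ge0 ?(ltW al0) ?(ltW s_gt0).
  rewrite -/(B c); move: hc; lra.
Qed.

(** [(b, (c, c'))] stands for the path [a, c, b, c', a']; the middle vertex comes first so that
    paths can be counted by fibres over it. *)
Definition paths4 (T : finType) (S : {set T}) (e : rel T) (a a' : T) :
    {set T * (T * T)} :=
  [set t | [&& t.1 \in S, t.2.1 \in codegree S e a t.1
                        & t.2.2 \in codegree S e t.1 a']].

(** Inside the set [N] of [dependent_choice], [A] keeps the vertices in bad pairs with at most a
    quarter of [N]. Any two of these share at least half of [N] as good middle vertices, each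
    carrying [(tau * s) ^ 2] paths. *)
Lemma many_paths4 (R : realFieldType) (T : finType) (S : {set T}) (e : rel T)
    (al : R) : symmetric e -> 0 < al -> S != set0 ->
    al * #|S|%:R ^+ 2 <= \sum_(a in S) \sum_(b in S) (e a b)%:R ->
  exists A : {set T},
    [/\ A \subset S, al / 2 * #|S|%:R <= #|A|%:R :> R &
        forall a a', a \in A -> a' \in A ->
          (al ^+ 2 / 32 * #|S|%:R) ^+ 2 * #|A|%:R
            <= 2 * #|paths4 S e a a'|%:R :> R].
Proof.
move=> sym_e al0 S0 dense.
have [N [NS bigN fewbad]] := dependent_choice sym_e al0 S0 dense.
set tau := al ^+ 2 / 32 in fewbad *; set s : R := #|S|%:R in bigN fewbad *.
have s_gt0 : 0 < s by rewrite ltr0n card_gt0.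
pose bad a b := #|codegree S e a b|%:R < tau * s.
have tau_ge0 : 0 <= tau by rewrite /tau !mulr_ge0 ?invr_ge0 ?sqr_ge0 ?(ltW al0).
pose Bad a := [set b in N | bad a b].
have fewBad : (16 * \sum_(a in N) #|Bad a| <= #|N| ^ 2)%N.
  rewrite -(ler_nat R) natrM natr_sum natrX.
  by under eq_bigr => a _ do rewrite natr_card_set.
pose A := [set a in N | 4 * #|Bad a| <= #|N|]%N.
have AN : A \subset N by apply/subsetP=> a; rewrite inE => /andP[].
have N_gt0 : (0 < #|N|)%N.
  rewrite -(ltr0n R) lt0r ler0n andbT.
  apply: contraTneq bigN => ->; rewrite expr0n /= -ltNge.
  by rewrite !mulr_gt0 ?exprn_gt0 ?invr_gt0.
(* Markov: a deleted vertex has more than [|N| / 4] bad partners, and there are at most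
   [|N| ^ 2 / 16] bad pairs. *)
have NA : (4 * #|N :\: A| <= #|N|)%N.
  have : (\sum_(a in N :\: A) #|N| <= \sum_(a in N :\: A) 4 * #|Bad a|)%N.
    by apply: leq_sum => a /setDP[aN]; rewrite inE aN /= -ltnNge => /ltnW.
  rewrite sum_nat_const -big_distrr /= => h1.
  have : (\sum_(a in N :\: A) #|Bad a| <= \sum_(a in N) #|Bad a|)%N.
    rewrite [X in (_ <= X)%N](big_setID A) /= (setIidPr AN).
    exact: leq_addl.
  move=> h2; rewrite -(leq_pmul2r N_gt0) -mulnA.
  apply: leq_trans (leq_mul (leqnn 4) h1) _.
  by rewrite (leq_trans _ fewBad) // mulnA leq_mul.
have cA := cardsID A N; rewrite (setIidPr AN) in cA.
exists A; split.
- exact: subset_trans NS.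
- have h1 : 3 * #|N|%:R <= 4 * #|A|%:R :> R by rewrite -!natrM ler_nat -cA; move: NA; rewrite -cA; move: #|A| #|_ :\: _|; clear; lia.
  have A0 : 0 <= #|A|%:R :> R by [].
  have N0 : 0 <= #|N|%:R :> R by [].
  rewrite -(@ler_pXn2r _ 2) ?nnegrE ?mulr_ge0 ?(ltW al0) ?(ltW s_gt0) ?invr_ge0 //.
  have : (3 * #|N|%:R) ^+ 2 <= (4 * #|A|%:R) ^+ 2 :> R.
    by rewrite ler_pXn2r ?nnegrE ?mulr_ge0.
  have : 0 <= al ^+ 2 * s ^+ 2 by rewrite mulr_ge0 ?sqr_ge0.
  rewrite !exprMn; move: bigN; lra.
move=> a a'; rewrite !inE => /andP[aN bada] /andP[a'N bada'].
pose good := N :\: (Bad a :|: Bad a').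
have good_ge : (#|A| <= 2 * #|good|)%N.
  have := subset_leq_card AN.
  have := cardsID (Bad a :|: Bad a') N; rewrite -/good.
  rewrite (setIidPr _); last first.
    by rewrite subUset; apply/andP; split; apply/subsetP=> b; rewrite inE => /andP[].
  have := leq_of_leqif (leq_card_setU (Bad a) (Bad a')).
  move: bada bada'; move: #|Bad a| #|Bad a'| #|good| #|A| #|N| #|_ :|: _|.
  clear; lia.
rewrite card_pair_sum natr_sum.
apply: le_trans (_ : 2 * \sum_(b in good) (tau * s) ^+ 2 <= _).
  rewrite sumr_const -[X in 2 * X]mulr_natl [leLHS]mulrC [leRHS]mulrA.
  rewrite ler_wpM2r ?sqr_ge0 //.
  by rewrite -natrM ler_nat.
rewrite ler_pM2l // [leLHS]big_mkcond /=; apply: ler_sum => b _.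
case: ifP => // /setDP[bN]; rewrite !inE bN /= negb_or -!leNgt => /andP[ga ga'].
have -> : [set u | (b, u) \in paths4 S e a a'] =
          setX (codegree S e a b) (codegree S e b a').
  by apply/setP=> -[c c']; rewrite !inE /= (subsetP NS _ bN).
have -> : codegree S e b a' = codegree S e a' b.
  by apply/setP=> c; rewrite !inE (sym_e c a') (sym_e b c) [e c b && _]andbC.
have ts_ge0 : 0 <= tau * s by rewrite mulr_ge0 // ltW.
by rewrite cardsX natrM expr2 ler_pM.
Qed.

(** Join [a] and [b] when [a + b] is in [S']. A path [a, c, b, c', a'] writes [a + a'] as a sum of
    four elements of [S'], and distinct paths give distinct quadruples, so every element of [A + A]
    uses up many of the [|S'| ^ 4] quadruples. *)
Lemma balog_szemeredi_gowers (R : realFieldType) (G : finZmodType)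
    (S S' : {set G}) (al : R) :
    (forall a : G, a + a = 0) -> 0 < al -> S != set0 ->
    al * #|S|%:R ^+ 2 <= \sum_(a in S) \sum_(b in S) (a + b \in S')%:R ->
  exists A : {set G},
    [/\ A \subset S, al / 2 * #|S|%:R <= #|A|%:R :> R &
        #|sumset A A|%:R * #|A|%:R * al ^+ 4 * #|S|%:R ^+ 2
          <= 2 ^+ 11 * #|S'|%:R ^+ 4 :> R].
Proof.
move=> char2 al0 S0 dense; pose e (a b : G) := a + b \in S'.
have sym_e : symmetric e by move=> a b; rewrite /e addrC.
have [A [AS Abig paths]] := many_paths4 sym_e al0 S0 dense.
exists A; split=> //.
pose Q := setX (setX S' S') (setX S' S').
pose sum4 (q : (G * G) * (G * G)) := (q.1.1 + q.1.2) + (q.2.1 + q.2.2).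
have cQ : #|S'|%:R ^+ 4 = \sum_d #|[set q in Q | sum4 q == d]|%:R :> R.
  rewrite -natr_sum; have -> : (#|S'|%:R ^+ 4 = #|Q|%:R :> R).
    by rewrite /Q !cardsX !natrM !exprS expr0 mulr1 !mulrA.
  congr (_%:R); rewrite -sum1_card (partition_big sum4 xpredT) //=.
  apply: eq_bigr => d _; rewrite -sum1_card; apply: eq_bigl => q.
  by rewrite !inE.
have low d : d \in sumset A A ->
    (al ^+ 2 / 32 * #|S|%:R) ^+ 2 * #|A|%:R
      <= 2 * #|[set q in Q | sum4 q == d]|%:R :> R.
  case/imset2P=> a a' aA a'A ->; apply: le_trans (paths _ _ aA a'A) _.
  rewrite ler_pM2l // ler_nat.
  pose h (t : G * (G * G)) := ((a + t.2.1, t.2.1 + t.1), (t.1 + t.2.2, t.2.2 + a')).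
  have h_inj : injective h.
    move=> [b [c c']] [b1 [c1 c1']] /= [/addrI ec eb _ /addIr ec'].
    by rewrite ec ec'; move: eb; rewrite ec => /addrI ->.
  rewrite -(card_imset _ h_inj); apply/subset_leq_card/subsetP.
  move=> _ /imsetP[[b [c c']] + ->]; rewrite !inE /= /e.
  case/and3P=> bS /and3P[cS -> ->] /and3P[c'S -> ->] /=.
  have cancel2 (x y z : G) : (x + y) + (y + z) = x + z.
    by rewrite addrA -(addrA x) char2 addr0.
  by rewrite /sum4 /= !cancel2.
have : \sum_(d in sumset A A) (al ^+ 2 / 32 * #|S|%:R) ^+ 2 * #|A|%:R
        <= 2 * #|S'|%:R ^+ 4 :> R.
  rewrite cQ mulr_sumr; apply: le_trans (ler_sum _ low) _.
  rewrite [leRHS](bigID (mem (sumset A A))) /= lerDl.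
  by apply: sumr_ge0 => d _; rewrite mulr_ge0.
rewrite sumr_const -[leLHS]mulr_natr.
move: (#|sumset A A|%:R) (#|S|%:R) (#|A|%:R) (#|S'|%:R) => x y z w.
have -> : (al ^+ 2 / 32 * y) ^+ 2 * z * x = (x * z * al ^+ 4 * y ^+ 2) / 1024 by field.
lra.
Qed.

(** * Fourier analysis of derivatives *)

Lemma sign_ofD (u v : 'F_2) : sign_of (u + v) = sign_of u * sign_of v.
Proof.
by case: u v => [[|[|u]] hu] [[|[|v]] hv] //; rewrite /sign_of /= ?mulr1 ?mul1r // mulrNN mulr1.
Qed.

Lemma sign_of_sqr (u : 'F_2) : sign_of u * sign_of u = 1.
Proof. by rewrite /sign_of; case: ifP; rewrite ?mulr1 // mulrNN mulr1. Qed.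

Lemma sign_of_pm1 (u : 'F_2) : sign_of u = 1 \/ sign_of u = -1.
Proof. by rewrite /sign_of; case: ifP; [left|right]. Qed.

Lemma F2_addrr (u : 'F_2) : u + u = 0.
Proof. by case: u => [[|[|u]] hu] //; apply/val_inj. Qed.

Lemma cube_addrr n (x : cube n) : x + x = 0.
Proof. by apply/rowP=> i; rewrite !mxE F2_addrr. Qed.

Lemma cube_addrK n (x y : cube n) : x + y + y = x.
Proof. by rewrite -addrA cube_addrr addr0. Qed.

Definition dot n (a x : cube n) : 'F_2 := (a *m x^T) ord0 ord0.
Definition chi n (a x : cube n) : RR := sign_of (dot a x).
Definition vol n : RR := #|{: cube n}|%:R.

Lemma dotC n (a x : cube n) : dot a x = dot x a.
Proof. by rewrite /dot -{1}(trmxK a) -trmx_mul mxE. Qed.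

Lemma dotDl n (a b x : cube n) : dot (a + b) x = dot a x + dot b x.
Proof. by rewrite /dot mulmxDl mxE. Qed.

Lemma dotDr n (a x y : cube n) : dot a (x + y) = dot a x + dot a y.
Proof. by rewrite dotC dotDl !(dotC a). Qed.

Lemma dot_mulmx n (a x : cube n) (T : 'M['F_2]_n) :
  dot (a *m T) x = dot a (x *m T^T).
Proof. by rewrite /dot trmx_mul trmxK mulmxA. Qed.

Lemma chiC n (a x : cube n) : chi a x = chi x a.
Proof. by rewrite /chi dotC. Qed.

Lemma chiDl n (a b x : cube n) : chi (a + b) x = chi a x * chi b x.
Proof. by rewrite /chi dotDl sign_ofD. Qed.

Lemma chiDr n (a x y : cube n) : chi a (x + y) = chi a x * chi a y.
Proof. by rewrite /chi dotDr sign_ofD. Qed.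

Lemma chi_sqr n (a x : cube n) : chi a x * chi a x = 1.
Proof. exact: sign_of_sqr. Qed.

Lemma chi0 n (x : cube n) : chi 0 x = 1.
Proof. by rewrite /chi /dot mul0mx mxE /sign_of eqxx. Qed.

Lemma chix0 n (a : cube n) : chi a 0 = 1.
Proof. by rewrite chiC chi0. Qed.

Lemma vol_gt0 n : 0 < vol n.
Proof. by rewrite ltr0n; apply/card_gt0P; exists 0. Qed.

Lemma sum_shift n (g : cube n -> RR) (y : cube n) : \sum_x g (x + y) = \sum_x g x.
Proof. by rewrite [RHS](reindex_inj (addIr y)). Qed.

(** For [a] nonzero, translation by a coordinate vector on which [chi a] is [-1] changes the sign of
    the sum. *)
Lemma sum_chi n (a : cube n) : \sum_x chi a x = (a == 0)%:R * vol n.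
Proof.
have [->|a0] := eqVneq a 0.
  by under eq_bigr => x _ do rewrite chi0; rewrite sumr_const mul1r.
have /existsP[i ai] : [exists i, a ord0 i != 0].
  apply: contraNT a0; rewrite negb_exists => /forallP a0.
  by apply/eqP/rowP=> i; rewrite mxE; apply/eqP; move: (a0 i); rewrite negbK.
have chi_i : chi a (delta_mx ord0 i) = -1.
  have -> : chi a (delta_mx ord0 i) = sign_of (a ord0 i).
    congr sign_of; rewrite /dot mxE (bigD1 i) //= big1.
      by rewrite !mxE !eqxx mulr1 addr0.
    by move=> j ji; rewrite !mxE (negbTE ji) andbF mulr0.
  by rewrite /sign_of (negbTE ai).
have := sum_shift (chi a) (delta_mx ord0 i).
under eq_bigr => x _ do rewrite chiDr chi_i mulrN1.
rewrite sumrN mul0r; lra.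
Qed.

(** Both the Fourier transform and the autocorrelation are unnormalised sums; powers of [vol n]
    appear in the identities instead. *)
Definition ft n (g : cube n -> RR) (a : cube n) : RR := \sum_x g x * chi a x.
Definition corr n (g : cube n -> RR) (w : cube n) : RR := \sum_x g x * g (x + w).

Lemma ft_inv n (g : cube n -> RR) (w : cube n) :
  \sum_a ft g a * chi a w = vol n * g w.
Proof.
rewrite /ft; under eq_bigr => a _ do rewrite mulr_suml.
rewrite exchange_big /= (bigD1 w) //= [X in _ + X]big1 ?addr0.
  under eq_bigr => a _ do rewrite -mulrA chi_sqr mulr1.
  by rewrite sumr_const -[LHS]mulr_natl.
move=> x xw; under eq_bigr => a _ do rewrite -mulrA -chiDr chiC.
rewrite -mulr_sumr sum_chi; have [e|] := eqVneq (x + w) 0; last by rewrite mul0r mulr0.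
by case/eqP: xw; rewrite -(cube_addrK x w) e add0r.
Qed.

Lemma ft_sqr n (g : cube n -> RR) (a : cube n) : ft g a ^+ 2 = ft (corr g) a.
Proof.
rewrite expr2 {1}/ft mulr_suml /ft /corr.
under [RHS]eq_bigr => w _ do rewrite mulr_suml.
rewrite [RHS]exchange_big; apply: eq_bigr => x _ /=.
rewrite mulr_sumr -(sum_shift _ x); apply: eq_bigr => w _.
rewrite chiDr [w + x]addrC.
by have := chi_sqr a x; move: (chi a x) (chi a w) (g x) (g _) => c d u v h; ring: h.
Qed.

Lemma parseval n (g : cube n -> RR) :
  \sum_a ft g a ^+ 2 = vol n * \sum_x g x ^+ 2.
Proof.
have := ft_inv (corr g) 0; rewrite /corr.
under [\sum_x g x * _]eq_bigr => x _ do rewrite addr0 -expr2.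
by move=> <-; apply: eq_bigr => a _; rewrite chix0 mulr1 ft_sqr.
Qed.

Definition deriv n (f : cube n -> RR) (y x : cube n) : RR := f x * f (x + y).
Definition amb n (f : cube n -> RR) (y a : cube n) : RR :=
  (ft (deriv f y) a / vol n) ^+ 2.

Lemma amb_ge0 n (f : cube n -> RR) (y a : cube n) : 0 <= amb f y a.
Proof. exact: sqr_ge0. Qed.

Lemma ambE n (f : cube n -> RR) (y a : cube n) :
  amb f y a = (vol n) ^- 2 * ft (corr (deriv f y)) a.
Proof. by rewrite /amb expr_div_n ft_sqr mulrC. Qed.

(** Both sides sum over [x] the product of [f] at the corners [x], [x + y], [x + w], [x + y + w].
    This symmetry is the source of the self-duality of [amb]. *)
Lemma corr_derivC n (f : cube n -> RR) (y w : cube n) :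
  corr (deriv f y) w = corr (deriv f w) y.
Proof.
apply: eq_bigr => x _; rewrite /deriv (addrAC x w y).
by rewrite mulrACA.
Qed.

Lemma sum_amb_chi n (f : cube n -> RR) (y w : cube n) :
  \sum_a amb f y a * chi a w = corr (deriv f y) w / vol n.
Proof.
have v0 : vol n != 0 by rewrite gt_eqF ?vol_gt0.
under eq_bigr => a _ do rewrite ambE -mulrA.
by rewrite -mulr_sumr ft_inv; field.
Qed.

Lemma pm1_sqr n (f : cube n -> RR) x : pm1_valued f -> f x * f x = 1.
Proof. by move=> hf; case: (hf x) => ->; rewrite ?mulr1 // mulrNN mulr1. Qed.

Lemma sum_amb n (f : cube n -> RR) (y : cube n) : pm1_valued f ->
  \sum_a amb f y a = 1.
Proof.
move=> hf; have := sum_amb_chi f y 0.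
under eq_bigr => a _ do rewrite chix0 mulr1.
move=> ->; rewrite /corr; under eq_bigr => x _.
  rewrite addr0 /deriv mulrACA !pm1_sqr // mulr1; over.
by rewrite sumr_const -/(vol n) mulfV // gt_eqF ?vol_gt0.
Qed.

Lemma amb_le1 n (f : cube n -> RR) (y a : cube n) : pm1_valued f -> amb f y a <= 1.
Proof.
move=> hf; rewrite -(sum_amb y hf) (bigD1 a) //= lerDl.
by apply: sumr_ge0 => b _; apply: amb_ge0.
Qed.

Definition sympl n (q p : cube n * cube n) : RR := chi q.2 p.1 * chi p.2 q.1.

Lemma symplD n (q p p' : cube n * cube n) :
  sympl q (p + p') = sympl q p * sympl q p'.
Proof. by rewrite /sympl /= chiDr chiDl mulrACA. Qed.

(** Summing over the frequency of [q] gives [corr (deriv f q.1) p.1]. By [corr_derivC] the roles of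
    [q.1] and [p.1] can be exchanged, and summing over [q.1] then transforms back to [amb]. *)
Lemma amb_self_dual n (f : cube n -> RR) (p : cube n * cube n) :
  \sum_(q : cube n * cube n) amb f q.1 q.2 * sympl q p = vol n * amb f p.1 p.2.
Proof.
case: p => y a /=; have v0 : vol n != 0 by rewrite gt_eqF ?vol_gt0.
rewrite -(pair_bigA _ (fun z b => amb f z b * sympl (z, b) (y, a))) /=.
under eq_bigr => z _.
  under eq_bigr => b _ do rewrite /sympl /= mulrA.
  rewrite -mulr_suml sum_amb_chi corr_derivC; over.
under eq_bigr => z _ do rewrite mulrAC.
by rewrite -mulr_suml ambE /ft; field.
Qed.

Lemma sum_amb_pairs n (f : cube n -> RR) : pm1_valued f ->
  \sum_(q : cube n * cube n) amb f q.1 q.2 = vol n.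
Proof.
move=> hf; rewrite -(pair_bigA _ (amb f)) /=.
by under eq_bigr => y _ do rewrite sum_amb //; rewrite sumr_const.
Qed.

(** Nonnegativity of the weighted variance of [X], scaled by [s] to avoid a division. *)
Lemma jensen_sqr (T : finType) (w X : T -> RR) (s : RR) :
    0 < s -> (forall t, 0 <= w t) -> \sum_t w t = s ->
  (\sum_t w t * X t) ^+ 2 <= s * \sum_t w t * X t ^+ 2.
Proof.
move=> s0 w0 ws; set m := \sum_t w t * X t.
have : 0 <= \sum_t w t * (s * X t - m) ^+ 2.
  by apply: sumr_ge0 => t _; rewrite mulr_ge0 ?sqr_ge0.
have -> (k : RR) : \sum_t w t * (s * X t - k) ^+ 2 =
    s ^+ 2 * (\sum_t w t * X t ^+ 2) - 2 * s * k * m + k ^+ 2 * s.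
  have -> : k ^+ 2 * s = \sum_t k ^+ 2 * w t by rewrite -mulr_sumr ws.
  rewrite /m !mulr_sumr -sumrB -big_split /=.
  by apply: eq_bigr => t _; ring.
move=> h; rewrite -(ler_pM2l s0); move: h; lra.
Qed.

(** By self-duality both sides are moments, first and second, of the character sum [X] under the
    nonnegative weight [amb f]; Jensen compares them. *)
Lemma amb_positive_definite n (f : cube n -> RR) (S : {set cube n * cube n}) :
    pm1_valued f ->
  (\sum_(p in S) amb f p.1 p.2) ^+ 2
    <= \sum_(p in S) \sum_(p' in S) amb f (p + p').1 (p + p').2.
Proof.
move=> hf; have v0 := vol_gt0 n; have v_neq0 : vol n != 0 by rewrite gt_eqF.
pose w (q : cube n * cube n) := amb f q.1 q.2.
pose X q := \sum_(p in S) sympl q p.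
have e1 : \sum_(p in S) w p = (vol n)^-1 * \sum_q w q * X q.
  under [in RHS]eq_bigr => q _ do rewrite mulr_sumr.
  rewrite exchange_big mulr_sumr; apply: eq_bigr => p _ /=.
  by rewrite amb_self_dual mulKf.
have e2 : \sum_(p in S) \sum_(p' in S) w (p + p') = (vol n)^-1 * \sum_q w q * X q ^+ 2.
  under [in RHS]eq_bigr => q _.
    rewrite expr2 {1}/X mulr_suml mulr_sumr.
    under eq_bigr => p _.
      rewrite /X mulr_sumr mulr_sumr.
      under eq_bigr => p' _ do rewrite -symplD.
      over.
    over.
  rewrite [in RHS]exchange_big mulr_sumr; apply: eq_bigr => p _ /=.
  rewrite [in RHS]exchange_big mulr_sumr; apply: eq_bigr => p' _ /=.
  by rewrite amb_self_dual mulKf.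
rewrite -/(w _) in e1 e2 *; rewrite e1 e2 exprMn.
have h := jensen_sqr X v0 (fun q => amb_ge0 f q.1 q.2) (sum_amb_pairs hf).
have -> : (vol n)^-1 * (\sum_q w q * X q ^+ 2) =
    (vol n)^-1 ^+ 2 * (vol n * \sum_q w q * X q ^+ 2) by field.
by rewrite ler_wpM2l ?sqr_ge0.
Qed.

(** * The [U_3] norm *)

(** Triples replace functions on ['I_3] and subsets of it, so that the product over the eight
    vertices of a cube can be written out. *)
Definition pick3 (T : Type) (t : T * T * T) (i : 'I_3) : T :=
  match val i with 0 => t.1.1 | 1 => t.1.2 | _ => t.2 end.

Lemma ord3E (i : 'I_3) : [\/ i = ord0, i = inord 1 | i = inord 2].
Proof.
case: i => [[|[|[|i]]] hi] //; [constructor 1|constructor 2|constructor 3];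
  by apply/val_inj; rewrite /= ?inordK.
Qed.

Lemma pick3K (T : Type) (g : 'I_3 -> T) (i : 'I_3) :
  pick3 (g ord0, g (inord 1), g (inord 2)) i = g i.
Proof. by case: (ord3E i) => ->; rewrite /pick3 /= ?inordK. Qed.

Lemma sum_ffun3 (V : finType) (F : {ffun 'I_3 -> V} -> RR) :
  \sum_y F y = \sum_a \sum_b \sum_c F (finfun (pick3 (a, b, c))).
Proof.
rewrite (reindex (fun t : V * V * V => finfun (pick3 t))) /=; last first.
  exists (fun y : {ffun 'I_3 -> V} => (y ord0, y (inord 1), y (inord 2))).
    by move=> [[a b] c] _; rewrite !ffunE /pick3 /= !inordK.
  by move=> y _; apply/ffunP=> i; rewrite ffunE pick3K.
rewrite pair_bigA pair_bigA /=.
by apply: eq_bigr => -[[a b] c] _.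
Qed.

Lemma prod_set3 (F : {set 'I_3} -> RR) :
  \prod_S F S = \prod_a \prod_b \prod_c F [set i | pick3 (a, b, c) i].
Proof.
rewrite (reindex (fun t : bool * bool * bool => [set i | pick3 t i])) /=; last first.
  exists (fun S : {set 'I_3} => (ord0 \in S, inord 1 \in S, inord 2 \in S)).
    by move=> [[a b] c] _; rewrite !inE /pick3 /= !inordK.
  by move=> S _; apply/setP=> i; rewrite inE (pick3K (fun i => i \in S)).
rewrite pair_bigA pair_bigA /=.
by apply: eq_bigr => -[[a b] c] _.
Qed.

Lemma sum_set3 (V : nmodType) (t : bool * bool * bool) (y : 'I_3 -> V) :
  \sum_(i in [set i | pick3 t i]) y i =
  y ord0 *+ t.1.1 + y (inord 1) *+ t.1.2 + y (inord 2) *+ t.2.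
Proof.
rewrite big_mkcond /= 3!big_ord_recr big_ord0 /= add0r !inE /=.
congr (_ + _ + _).
- by rewrite /pick3 /=; case: t.1.1; rewrite ?mulr1n ?mulr0n //; congr y; apply/val_inj.
- by rewrite /pick3 /=; case: t.1.2; rewrite ?mulr1n ?mulr0n //; congr y; apply/val_inj; rewrite /= inordK.
- by rewrite /pick3 /=; case: t.2; rewrite ?mulr1n ?mulr0n //; congr y; apply/val_inj; rewrite /= inordK.
Qed.

(** For fixed directions [a] and [b], the sum over the base point and the third direction is
    [corr (deriv f a) b ^ 2]. Parseval in [b] turns these squares into squares of [amb]. *)
Lemma gowers3_pow n (f : cube n -> RR) :
  gowers_norm 3 f ^+ 8 = (\sum_(p : cube n * cube n) amb f p.1 p.2 ^+ 2) / vol n.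
Proof.
have v0 : vol n != 0 by rewrite gt_eqF ?vol_gt0.
set X := RHS; rewrite /gowers_norm; set Y := avg _.
have -> : Y = X.
  rewrite /Y /avg card_ffun card_ord -/(vol n) natrX -/(vol n) -mulr_sumr.
  transitivity (vol n ^- 4 * \sum_y \sum_w corr (deriv f y) w ^+ 2).
    rewrite mulrA -invfM -exprS; congr (_ * _).
    under eq_bigr => x _ do rewrite sum_ffun3.
    rewrite exchange_big; apply: eq_bigr => a _ /=.
    rewrite exchange_big; apply: eq_bigr => b _ /=.
    rewrite expr2 /corr mulr_suml; apply: eq_bigr => x _.
    (* Writing the second base point as [c + x] makes [c] the third direction. *)
    rewrite -[in RHS](sum_shift _ x) mulr_sumr; apply: eq_bigr => c _.
    rewrite prod_set3 !big_bool !sum_set3 /= !ffunE /pick3 /= !inordK //.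
    rewrite !mulr1n !mulr0n !addr0 !add0r /deriv [c + x]addrC !addrA.
    rewrite !(addrAC _ b a) !(addrAC _ c a) !(addrAC _ c b); ring.
  rewrite /X -(pair_bigA _ (fun y a => amb f y a ^+ 2)) /=.
  rewrite [RHS]mulrC !mulr_sumr; apply: eq_bigr => y _.
  under [in RHS]eq_bigr => a _ do rewrite ambE exprMn.
  by rewrite -mulr_sumr parseval; field.
(* The eighth power undoes the real root because its base is nonnegative. *)
have X_ge0 : 0 <= X.
  rewrite /X divr_ge0 ?(ltW (vol_gt0 n)) //.
  by apply: sumr_ge0 => p _; apply: sqr_ge0.
rewrite -powR_mulrn ?powR_ge0 // -powRrM.
rewrite (_ : _ * _ = 1) ?powRr1 //.
by rewrite mulVf // pnatr_eq0.
Qed.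

(** * Symmetry and quadratic phases *)

Lemma pm1M (a b : RR) : a = 1 \/ a = -1 -> b = 1 \/ b = -1 -> a * b = 1 \/ a * b = -1.
Proof.
by case=> -> [] ->; rewrite ?mul1r ?mulN1r ?opprK; [left|right|right|left].
Qed.

(* The symmetry argument: substituting [y = s + x + z] decouples [x] and [z]
   up to the bilinear phase of [T + T^T]. *)
Lemma sum_ft_deriv_linear n (f : cube n -> RR) (T : 'M['F_2]_n) (b : cube n) :
  let h s x := f x * f (x + s) * chi (s *m T + b) x * chi (x *m T) x in
  \sum_y ft (deriv f y) (y *m T + b) ^+ 2 =
  \sum_s \sum_x h s x * ft (h s) (x *m (T + T^T)).
Proof.
move=> h.
under eq_bigr => y _.
  rewrite expr2 {1}/ft mulr_suml.
  under eq_bigr => x _ do rewrite /ft mulr_sumr; over.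
under [RHS]eq_bigr => s _ do under eq_bigr => x _ do rewrite /ft mulr_sumr.
rewrite exchange_big [RHS]exchange_big; apply: eq_bigr => x _ /=.
rewrite exchange_big [RHS]exchange_big; apply: eq_bigr => z _ /=.
rewrite -(sum_shift _ (x + z)); apply: eq_bigr => s _.
rewrite /deriv /h.
have -> : x + (s + (x + z)) = z + s.
  by rewrite addrCA (addrA x x) cube_addrr add0r addrC.
have -> : z + (s + (x + z)) = x + s.
  by rewrite addrCA (addrC x z) (addrA z z) cube_addrr add0r addrC.
have e : chi (x *m T^T) z = chi (z *m T) x.
  by rewrite /chi (dot_mulmx x z T^T) trmxK dotC.
rewrite !mulmxDl mulmxDr !chiDl e.
move: (f _) (f _) (f _) (f _) (chi _ _) (chi _ _) (chi _ _) (chi _ _) (chi _ _) (chi _ _).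
by move=> *; ring.
Qed.

Lemma exists_ge_mean n (phi : cube n -> RR) (m : RR) :
  m * vol n <= \sum_x phi x -> exists x, m <= phi x.
Proof.
move=> hm; have [] := @exists_ge_average RR (cube n) [set: cube n] phi m.
- by apply/set0Pn; exists 0.
- rewrite cardsT -/(vol n); apply: le_trans hm _.
  by rewrite [leRHS](eq_bigl xpredT) // => x; rewrite inE.
by move=> x _ hx; exists x.
Qed.

(** Expand the squares as transforms of [corr h]. The sum over [x] of the characters vanishes unless
    [w *m Q^T = 0], and there [corr h w] is at most [vol n]. *)
Lemma ft_mulmx_sqr_sum n (h : cube n -> RR) (Q : 'M['F_2]_n) : pm1_valued h ->
  \sum_x ft h (x *m Q) ^+ 2 <= vol n ^+ 2 * #|[set w : cube n | w *m Q^T == 0]|%:R.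
Proof.
move=> hh; under eq_bigr => x _ do rewrite ft_sqr /ft.
rewrite exchange_big /= -sum1_card natr_sum mulr_sumr [leRHS]big_mkcond /=.
apply: ler_sum => w _; rewrite inE.
under eq_bigr => x _ do rewrite {1}/chi dot_mulmx -/(chi x (w *m Q^T)) chiC.
rewrite -mulr_sumr sum_chi; case: eqP => _; last by rewrite mul0r mulr0.
rewrite mul1r mulr1 expr2 ler_wpM2r ?(ltW (vol_gt0 n)) //.
rewrite /vol -sumr_const; apply: ler_sum => x _.
by case: (hh x) (hh (x + w)) => -> [] ->; lra.
Qed.

(** A good [s] in the decoupled sum leaves a correlation of [h s] with its own transform along
    [T + T^T]. Cauchy-Schwarz and [ft_mulmx_sqr_sum] bound this by the size of the kernel. *)
Lemma symmetry_argument n (f : cube n -> RR) (T : 'M['F_2]_n) (b : cube n) (eta : RR) :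
    pm1_valued f -> 0 <= eta ->
    eta * vol n <= \sum_y amb f y (y *m T + b) ->
  eta ^+ 2 * vol n <= #|[set w : cube n | w *m (T + T^T) == 0]|%:R.
Proof.
move=> hf eta0 big_eta; have v0 := vol_gt0 n.
have v_neq0 : vol n != 0 by rewrite gt_eqF.
set Q := T + T^T; pose h s x := f x * f (x + s) * chi (s *m T + b) x * chi (x *m T) x.
have h_pm1 s : pm1_valued (h s).
  by move=> x; rewrite /h /chi; do !apply: pm1M => //; apply: sign_of_pm1.
have [s hs] : exists s, eta * vol n ^+ 2 <= \sum_x h s x * ft (h s) (x *m Q).
  apply: exists_ge_mean; rewrite -sum_ft_deriv_linear.
  have -> : \sum_y ft (deriv f y) (y *m T + b) ^+ 2 =
            vol n ^+ 2 * \sum_y amb f y (y *m T + b).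
    by rewrite mulr_sumr; apply: eq_bigr => y _; rewrite /amb; field.
  by rewrite mulrAC mulrC ler_wpM2l ?sqr_ge0.
pose P := \sum_x h s x * ft (h s) (x *m Q); pose E := \sum_x ft (h s) (x *m Q) ^+ 2.
have cs : P ^+ 2 <= vol n * E.
  have -> : P = \sum_x 1 * (h s x * ft (h s) (x *m Q)).
    by apply: eq_bigr => x _; rewrite mul1r.
  have -> : E = \sum_x 1 * (h s x * ft (h s) (x *m Q)) ^+ 2.
    by apply: eq_bigr => x _; rewrite mul1r exprMn [h s x ^+ 2]expr2 pm1_sqr ?mul1r.
  by apply: jensen_sqr => //; rewrite sumr_const.
have ub := ft_mulmx_sqr_sum Q (h_pm1 s).
have QT : Q^T = Q by rewrite /Q linearD /= trmxK addrC.
rewrite QT -/E in ub; rewrite -/P in hs.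
have sq : (eta * vol n ^+ 2) ^+ 2 <= P ^+ 2.
  by rewrite ler_pXn2r ?nnegrE ?mulr_ge0 ?sqr_ge0 //; apply: le_trans hs; rewrite mulr_ge0 ?sqr_ge0.
have v3 : 0 < vol n ^+ 3 by rewrite exprn_gt0.
rewrite -(ler_pM2l v3).
have : vol n * E <= vol n * (vol n ^+ 2 * #|[set w : cube n | w *m Q == 0]|%:R).
  by rewrite ler_pM2l.
move: sq cs; lra.
Qed.

Lemma F2_sqr (u : 'F_2) : u * u = u.
Proof. by case: u => [[|[|u]] hu] //; apply/val_inj. Qed.

Lemma F2_neq0 (u : 'F_2) : u != 0 -> u = 1.
Proof. by case: u => [[|[|u]] hu] //; move=> _; apply/val_inj. Qed.

Lemma mx_F2_opp m n (A : 'M['F_2]_(m, n)) : - A = A.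
Proof.
by apply/matrixP=> i j; rewrite !mxE; apply: (addrI (A i j)); rewrite subrr F2_addrr.
Qed.

(* With [P] a projection onto [ker (T - T^T)], where [T] is a symmetric form,
   [P T + (1 - P) T^T P^T] is symmetric and agrees with [T] on the kernel. *)
Lemma symmetric_extension (F : fieldType) n (T : 'M[F]_n) :
  exists A : 'M[F]_n,
    A^T = A /\ forall w : 'rV[F]_n, w *m (T - T^T) = 0 -> w *m A = w *m T.
Proof.
have [P [PT PK]] : exists P : 'M[F]_n, P *m T = P *m T^T /\
    forall w : 'rV[F]_n, w *m (T - T^T) = 0 -> w *m P = w.
  pose K := kermx (T - T^T); exists (pinvmx K *m K); split.
    by apply/eqP; rewrite -subr_eq0 -mulmxBr -mulmxA mulmx_ker mulmx0.
  by move=> w /sub_kermxP wK; rewrite mulmxA mulmxKpV.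
exists (P *m T + T^T *m P^T - P *m T^T *m P^T); split.
  have -> : P *m T^T *m P^T = P *m T *m P^T by rewrite PT.
  have e : (P *m T)^T = T^T *m P^T by rewrite trmx_mul.
  have e' : (T^T *m P^T)^T = P *m T by rewrite -e trmxK.
  rewrite linearB linearD /= e e' [T^T *m P^T + _]addrC; congr (_ - _).
  by rewrite trmx_mul trmxK e (mulmxA P) PT.
by move=> w /PK wP; rewrite mulmxBr mulmxDr !mulmxA wP addrK.
Qed.

(** If [d] is the diagonal of the symmetric [A], then [A + d^T *m d] has zero diagonal since
    [u * u = u], and it agrees with [A] where [dot w d = 0], which costs the factor 2. A symmetric
    matrix with zero diagonal is [M + M^T] for its strict upper triangle [M]. *)
Lemma alternating_extension n (T : 'M['F_2]_n) :
  exists (M : 'M['F_2]_n) (W : {set cube n}),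
    (#|[set w : cube n | w *m (T + T^T) == 0%R]| <= 2 * #|W|)%N /\
    forall w, w \in W -> w *m (M + M^T) = w *m T.
Proof.
have [A [symA AT]] := symmetric_extension T.
rewrite mx_F2_opp in AT.
pose d : cube n := \row_i A i i.
have [B [symB diagB BT]] : exists B : 'M['F_2]_n,
    [/\ forall i j, B i j = B j i, forall i, B i i = 0 &
        forall w : cube n, w *m (T + T^T) = 0 -> dot w d = 0 -> w *m B = w *m T].
  have BE i j : (A + d^T *m d) i j = A i j + A i i * A j j.
    by rewrite !mxE big_ord1 !mxE.
  exists (A + d^T *m d); split.
  - by move=> i j; rewrite !BE [A i i * _]mulrC -{1}symA mxE.
  - by move=> i; rewrite BE F2_sqr F2_addrr.
  - move=> w wk wd; rewrite mulmxDr AT // mulmxA.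
    have -> : w *m d^T = 0 by apply/matrixP=> i j; rewrite !ord1 [RHS]mxE.
    by rewrite mul0mx addr0.
pose M : 'M['F_2]_n := \matrix_(i, j) if (i < j)%N then B i j else 0.
have MB : M + M^T = B.
  apply/matrixP=> i j; rewrite !mxE.
  case: (ltngtP i j) => [_|_|ij]; rewrite ?addr0 ?add0r //.
  by rewrite (val_inj ij) diagB.
pose ker := [set w : cube n | w *m (T + T^T) == 0].
pose W := [set w in ker | dot w d == 0].
exists M, W; split.
  have [sub|/subsetPn[w0 w0k nw0]] := boolP (ker \subset W).
    by apply: leq_trans (subset_leq_card sub) _; rewrite leq_pmull.
  have w0d : dot w0 d = 1.
    by apply: F2_neq0; move: nw0; rewrite inE w0k.
  have WK : W \subset ker by apply/subsetP=> w; rewrite inE => /andP[].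
  rewrite -(cardsID W ker) (setIidPr WK) mul2n -addnn leq_add2l.
  rewrite -(card_imset (mem (ker :\: W)) (addIr w0)).
  apply/subset_leq_card/subsetP => _ /imsetP[w /setDP[wk nw] ->].
  have wd : dot w d = 1 by apply: F2_neq0; move: nw; rewrite inE wk.
  rewrite inE dotDl wd w0d F2_addrr eqxx andbT.
  move: wk w0k; rewrite !inE mulmxDl => /eqP -> /eqP ->.
  by rewrite addr0.
by move=> w; rewrite !inE MB => /andP[/eqP wk /eqP wd]; apply: BT.
Qed.

Definition qform n (M : 'M['F_2]_n) (x : cube n) : 'F_2 := dot (x *m M) x.

Lemma qformD n (M : 'M['F_2]_n) (x u : cube n) :
  qform M (x + u) = qform M x + qform M u + dot (u *m (M + M^T)) x.
Proof.
rewrite /qform mulmxDl !dotDl !dotDr mulmxDr dotDl.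
have -> : dot (u *m M^T) x = dot (x *m M) u by rewrite (dot_mulmx u x M^T) trmxK dotC.
have perm4 (p q r s : 'F_2) : p + q + (r + s) = p + s + (r + q).
  by rewrite addrACA [RHS]addrACA (addrC q).
exact: perm4.
Qed.

(** The derivative of [qform M] in direction [u] is linear with frequency [u *m (M + M^T)], up to a
    constant sign that squaring removes. *)
Lemma amb_quadratic_twist n (f : cube n -> RR) (M : 'M['F_2]_n) (u b : cube n) :
  amb f u (b + u *m (M + M^T)) = amb (fun x => f x * sign_of (qform M x)) u b.
Proof.
set g := fun x => _.
have e : ft (deriv g u) b = sign_of (qform M u) * ft (deriv f u) (b + u *m (M + M^T)).
  rewrite /ft mulr_sumr; apply: eq_bigr => x _.
  rewrite chiDl /deriv /g qformD !sign_ofD -/(chi _ x).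
  have := sign_of_sqr (qform M x); move: (sign_of (qform M x)) => s hs.
  by ring: hs.
by rewrite /amb e -mulrA [RHS]exprMn [sign_of _ ^+ 2]expr2 sign_of_sqr mul1r.
Qed.

(** The sum is the transform of [corr g ^ 2] at [b], hence at most the sum of [corr g ^ 2]. By
    Parseval this is a fourth moment of [ft g]; extract the largest square and apply Parseval
    again. *)
Lemma sum_amb_le_ft n (g : cube n -> RR) (b : cube n) : pm1_valued g ->
  exists a, vol n * \sum_u amb g u b <= ft g a ^+ 2.
Proof.
move=> hg; have v0 := vol_gt0 n; have v_neq0 : vol n != 0 by rewrite gt_eqF.
have [a _ maxa] := @Order.TotalTheory.arg_maxP _ _ (cube n) 0 xpredT (fun a => ft g a ^+ 2) isT.
exists a.
have -> : \sum_u amb g u b = vol n ^- 2 * \sum_w corr g w ^+ 2 * chi b w.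
  under eq_bigr => u _ do rewrite ambE.
  rewrite -mulr_sumr /ft exchange_big; congr (_ * _); apply: eq_bigr => w _ /=.
  rewrite -mulr_suml; congr (_ * _).
  under eq_bigr => u _ do rewrite corr_derivC.
  rewrite expr2 {2}/corr mulr_suml exchange_big; apply: eq_bigr => x _ /=.
  rewrite /corr mulr_sumr -[in RHS](sum_shift _ x); apply: eq_bigr => u _.
  by rewrite /deriv [u + x]addrC.
have le1 : \sum_w corr g w ^+ 2 * chi b w <= \sum_w corr g w ^+ 2.
  apply: ler_sum => w _; have := sqr_ge0 (corr g w).
  by rewrite /chi; case: (sign_of_pm1 (dot b w)) => ->; lra.
have le2 : vol n * \sum_w corr g w ^+ 2 <= ft g a ^+ 2 * vol n ^+ 2.
  rewrite -parseval.
  under eq_bigr => c _ do rewrite -ft_sqr.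
  apply: le_trans (_ : \sum_c ft g a ^+ 2 * ft g c ^+ 2 <= _).
    by apply: ler_sum => c _; rewrite [leLHS]expr2; apply: ler_wpM2r;
      [exact: sqr_ge0|exact: maxa].
  rewrite -mulr_sumr parseval; under eq_bigr => x _ do rewrite expr2 pm1_sqr //.
  by rewrite sumr_const -/(vol n) -expr2.
have v2 : 0 < vol n ^+ 2 by rewrite exprn_gt0.
rewrite -(ler_pM2r v2); apply: le_trans le2.
have -> : vol n * (vol n ^- 2 * \sum_w corr g w ^+ 2 * chi b w) * vol n ^+ 2 =
          vol n * \sum_w corr g w ^+ 2 * chi b w by field.
by rewrite ler_pM2l.
Qed.

(** * Linear structure *)

HB.saturate prod.

(* The row space of the matrix listing [A] is a subset of [Z]; the linear map is
   read off a pseudo-inverse of its first block. *)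
Lemma linear_graph_cover n (A Z : {set cube n * cube n}) :
    0 \in Z -> (forall z a, z \in Z -> a \in A -> z + a \in Z) ->
  exists T : 'M['F_2]_n,
    (#|[set p.1 | p in A]| * #|[set (p.1 *m T + p.2)%R | p in A]| <= #|Z|)%N.
Proof.
move=> Z0 ZA.
pose H1 : 'M['F_2]_(#|A|, n) := \matrix_(i < #|A|) (enum_val i).1.
pose H2 : 'M['F_2]_(#|A|, n) := \matrix_(i < #|A|) (enum_val i).2.
have span_Z (u : 'rV['F_2]_#|A|) : (u *m H1, u *m H2) \in Z.
  rewrite !mulmx_sum_row; elim: (index_enum _) => [|i s IH]; first by rewrite !big_nil.
  rewrite !big_cons !rowK; have [->|/F2_neq0 ->] := eqVneq (u ord0 i) 0.
    by rewrite !scale0r !add0r.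
  rewrite !scale1r [(enum_val i).1 + _]addrC [(enum_val i).2 + _]addrC.
  exact: (ZA _ _ IH (enum_valP i)).
have rowA p : p \in A -> exists u, u *m H1 = p.1 /\ u *m H2 = p.2.
  move=> pA; exists (delta_mx ord0 (enum_rank_in pA p)).
  by rewrite -!rowE !rowK enum_rankK_in.
exists (pinvmx H1 *m H2); set T := pinvmx H1 *m H2.
have graphA p : p \in A -> exists u, u *m H1 = p.1 /\ u *m H2 = p.1 *m T.
  move=> /rowA[u [u1 _]]; exists (p.1 *m pinvmx H1); split.
    by rewrite mulmxKpV // -u1 submxMl.
  exact: (esym (mulmxA _ _ _)).
pose h (q : cube n * cube n) := (q.1, q.1 *m T + q.2).
have h_inj : injective h by move=> [y b] [y' b'] [-> /addrI ->].
rewrite -cardsX -(card_imset _ h_inj); apply/subset_leq_card/subsetP.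
move=> _ /imsetP[[y b] /setXP[/= /imsetP[p pA ->] /imsetP[p' p'A ->]] ->].
have [u [u1 u2]] := graphA _ pA; have [u' [u'1 u'2]] := graphA _ p'A.
have [w [w1 w2]] := rowA _ p'A.
(* The three combinations give [(p.1, p.1 *m T)], [(p'.1, p'.1 *m T)] and [p']; the two copies of
   [p'.1] cancel. *)
have := span_Z (u + (u' + w)).
by rewrite !mulmxDl u1 u2 u'1 u'2 w1 w2 cube_addrr addr0.
Qed.

Lemma sum_le_graphs n (F : cube n -> cube n -> RR) (A : {set cube n * cube n})
    (T : 'M['F_2]_n) : (forall y a, 0 <= F y a) ->
  \sum_(p in A) F p.1 p.2
    <= \sum_(b in [set p.1 *m T + p.2 | p in A]) \sum_y F y (y *m T + b).
Proof.
move=> F0; rewrite (partition_big_imset (fun p => p.1 *m T + p.2)) /=.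
apply: ler_sum => b _.
have -> : \sum_y F y (y *m T + b) =
          \sum_(p : cube n * cube n | p.1 *m T + p.2 == b) F p.1 p.2.
  rewrite -(pair_big_dep xpredT (fun y a => y *m T + a == b) F) /=.
  apply: eq_bigr => y _; rewrite (big_pred1 (y *m T + b)) // => a.
  by apply/eqP/eqP => [<-|->]; rewrite addrA cube_addrr add0r.
rewrite big_mkcond [leRHS]big_mkcond /=; apply: ler_sum => p _.
by case: (p \in A); case: eqP => //= _.
Qed.

Lemma linear_structure n (f : cube n -> RR) (rho : RR) :
    pm1_valued f -> 0 < rho ->
    2 * rho * vol n <= \sum_(p : cube n * cube n) amb f p.1 p.2 ^+ 2 ->
  let K := 2 ^+ 23 / rho ^+ 24 in
  exists (T : 'M['F_2]_n) (b : cube n) (d : nat),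
    d%:R <= K ^+ 3 /\
    rho ^+ 5 / (4 * K * 2 ^+ d) * vol n <= \sum_y amb f y (y *m T + b).
Proof.
move=> hf rho0 big2 K; have v0 := vol_gt0 n.
pose F (p : cube n * cube n) := amb f p.1 p.2.
have F0 p : 0 <= F p by apply: amb_ge0.
have F1 p : F p <= 1 by apply: amb_le1.
have sumF : \sum_p F p = vol n by apply: sum_amb_pairs.
(* On average over pairs in [S], [F (p + p')] is at least [rho ^ 2]. Pairs with sum outside [S']
   account for at most half of this. *)
pose al := rho ^+ 2 / 2; have al0 : 0 < al by rewrite divr_gt0 ?exprn_gt0.
pose S := [set p | rho <= F p]; pose S' := [set p | al <= F p].
have Sbig : rho * vol n <= #|S|%:R.
  have : \sum_p F p ^+ 2 <= #|S|%:R + rho * vol n.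
    rewrite -sumF mulr_sumr natr_card -big_split /=.
    apply: ler_sum => p _; rewrite inE; have := F0 p; have := F1 p.
    case: (lerP rho (F p)) => /= hp F1p F0p; first by nra.
    by rewrite add0r expr2 ler_wpM2r // ltW.
  move: big2; rewrite -/(F _); lra.
have s_gt0 : 0 < #|S|%:R :> RR by apply: lt_le_trans Sbig; rewrite mulr_gt0.
have S0 : S != set0 by rewrite -card_gt0 -(ltr0n RR).
have S'small : al * #|S'|%:R <= vol n.
  rewrite -sumF natr_card mulr_sumr; apply: ler_sum => p _; rewrite inE.
  by case: (lerP al (F p)); rewrite ?mulr1 ?mulr0.
have dense : al * #|S|%:R ^+ 2 <= \sum_(a in S) \sum_(b in S) (a + b \in S')%:R.
  have h1 : (rho * #|S|%:R) ^+ 2 <= \sum_(p in S) \sum_(p' in S) F (p + p').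
    apply: le_trans (amb_positive_definite S hf).
    rewrite ler_pXn2r ?nnegrE ?mulr_ge0 ?(ltW rho0) //; last first.
      by apply: sumr_ge0 => p _; apply: F0.
    by rewrite mulr_natr -sumr_const; apply: ler_sum => p; rewrite inE.
  have h2 : \sum_(p in S) \sum_(p' in S) F (p + p') <=
            \sum_(p in S) \sum_(p' in S) ((p + p' \in S')%:R + al).
    apply: ler_sum => p _; apply: ler_sum => p' _; rewrite [_ \in S']inE.
    have := F1 (p + p'); case: (lerP al (F (p + p'))) => /=; move: al0; lra.
  have h3 : \sum_(p in S) \sum_(p' in S) ((p + p' \in S')%:R + al) =
      \sum_(a in S) \sum_(b in S) (a + b \in S')%:R + al * #|S|%:R ^+ 2.
    under eq_bigr => p _ do rewrite big_split sumr_const /=.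
    rewrite big_split sumr_const /=; congr (_ + _).
    by rewrite -mulrnA -[LHS]mulr_natr natrM expr2.
  rewrite h3 in h2; move: (le_trans h1 h2); rewrite /al; lra.
have char2 (p : cube n * cube n) : p + p = 0.
  by case: p => y a; congr pair; apply: cube_addrr.
have [A [AS Abig AA]] := balog_szemeredi_gowers char2 al0 S0 dense.
have al2_gt0 : 0 < al / 2 by apply: divr_gt0.
have a_gt0 : 0 < #|A|%:R :> RR.
  by apply: lt_le_trans Abig; rewrite mulr_gt0.
have A0 : A != set0 by rewrite -card_gt0 -(ltr0n RR).
have K_gt0 : 0 < K by rewrite divr_gt0 ?exprn_gt0.
have Alow : rho ^+ 3 / 4 * vol n <= #|A|%:R.
  apply: le_trans Abig; apply: le_trans (_ : al / 2 * (rho * vol n) <= _).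
    by rewrite /al; lra.
  by rewrite ler_pM2l.
(* [K] results from [|S'| <= vol n / al], [|A| >= rho ^ 3 / 4 * vol n] and [|S| >= rho * vol n]; the
   powers of two are [2 ^ (11 + 8 + 4)]. *)
have dbl : #|sumset A A|%:R <= K * #|A|%:R.
  have D0 : 0 < #|A|%:R * al ^+ 4 * #|S|%:R ^+ 2 :> RR.
    by rewrite !mulr_gt0 ?exprn_gt0.
  rewrite -(ler_pM2r D0) [leLHS](_ : _ =
    #|sumset A A|%:R * #|A|%:R * al ^+ 4 * #|S|%:R ^+ 2); last by ring.
  apply: le_trans AA _.
  have al_neq0 : al != 0 by rewrite gt_eqF.
  have rho_neq0 : rho != 0 by rewrite gt_eqF.
  apply: le_trans (_ : 2 ^+ 11 * (vol n / al) ^+ 4 <= _).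
    have s'le : #|S'|%:R <= vol n / al by rewrite ler_pdivlMr // mulrC.
    have : 0 <= vol n / al by apply: divr_ge0; apply: ltW.
    by move=> va; rewrite ler_pM2l ?exprn_gt0 // lerXn2r ?nnegrE.
  have a2 : (rho ^+ 3 / 4 * vol n) ^+ 2 <= #|A|%:R ^+ 2 :> RR.
    by rewrite lerXn2r ?nnegrE ?mulr_ge0 ?exprn_ge0 ?(ltW v0) ?(ltW rho0).
  have s2 : (rho * vol n) ^+ 2 <= #|S|%:R ^+ 2 :> RR.
    by rewrite lerXn2r ?nnegrE ?mulr_ge0 ?(ltW v0) ?(ltW rho0).
  have -> : 2 ^+ 11 * (vol n / al) ^+ 4 =
      K * al ^+ 4 * ((rho ^+ 3 / 4 * vol n) ^+ 2 * (rho * vol n) ^+ 2).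
    by rewrite /K /al; field.
  rewrite [leRHS](_ : _ = K * al ^+ 4 * (#|A|%:R ^+ 2 * #|S|%:R ^+ 2)); last by ring.
  apply: ler_wpM2l; last by apply: ler_pM => //; apply: sqr_ge0.
  by apply: mulr_ge0; [apply: ltW|apply/exprn_ge0/ltW].
have [Z [d [Z0 ZA dK cZ]]] := span_of_small_doubling char2 A0 dbl.
have [T cT] := linear_graph_cover Z0 ZA.
exists T; pose Bs := [set p.1 *m T + p.2 | p in A].
(* For each [y] the values [amb f y a] sum to 1, so at most [1 / rho] of them reach [rho]. *)
have fibers : rho * #|A|%:R <= #|[set p.1 | p in A]|%:R.
  rewrite card_pair_sum natr_sum mulr_sumr [leRHS]natr_card.
  apply: ler_sum => y _; have [_|ny] := boolP (y \in _).
    rewrite -[leRHS](sum_amb y hf) natr_card mulr_sumr.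
    apply: ler_sum => a _; rewrite inE; have [yaA|_] := boolP (_ \in A).
      by move/(subsetP AS): yaA; rewrite inE mulr1.
    by rewrite mulr0 amb_ge0.
  rewrite (_ : [set u | _] = set0) ?cards0 ?mulr0 //.
  apply/eqP; rewrite -subset0; apply/subsetP=> a; rewrite inE => yaA.
  by case/negP: ny; apply/imsetP; exists (y, a).
have Bs0 : Bs != set0.
  by have [p pA] := set0Pn _ A0; apply/set0Pn; exists (p.1 *m T + p.2); apply: imset_f.
have pow0 : 0 < 2 ^+ d :> RR by rewrite exprn_gt0.
(* Few graphs cover [A], so one of them carries a large share of the mass of [amb f] on [A]. *)
have Bsmall : rho * #|Bs|%:R <= 2 ^+ d * K.
  rewrite -(ler_pM2r a_gt0); apply: le_trans cZ.
  rewrite mulrAC; apply: le_trans (_ : (#|[set p.1 | p in A]| * #|Bs|)%:R <= _).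
    by rewrite natrM ler_wpM2r.
  by rewrite ler_nat.
have [] := @exists_ge_average RR _ Bs (fun b => \sum_y amb f y (y *m T + b))
  (rho ^+ 5 / (4 * K * 2 ^+ d) * vol n) Bs0.
  apply: le_trans (sum_le_graphs A T (amb_ge0 f)).
  apply: le_trans (_ : rho * #|A|%:R <= _); last first.
    rewrite mulr_natr -sumr_const; apply: ler_sum => p /(subsetP AS).
    by rewrite inE.
  have -> : rho ^+ 5 / (4 * K * 2 ^+ d) * vol n * #|Bs|%:R =
     (rho ^+ 4 / 4 * vol n) * (rho * #|Bs|%:R / (2 ^+ d * K)).
    by field; rewrite !gt_eqF.
  apply: le_trans (_ : rho ^+ 4 / 4 * vol n <= _).
    rewrite ler_piMr ?mulr_ge0 ?exprn_ge0 ?(ltW v0) ?(ltW rho0) //.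
    have D0 : 0 < 2 ^+ d * K by apply: mulr_gt0.
    by rewrite (ler_pdivrMr _ _ D0) mul1r.
  have -> : rho ^+ 4 / 4 * vol n = rho * (rho ^+ 3 / 4 * vol n) by field.
  by rewrite ler_pM2l.
by move=> b _ hb; exists b, d.
Qed.

(** * The inverse theorem *)

Lemma dotE n (a x : cube n) : dot a x = \sum_i a ord0 i * x ord0 i.
Proof. by rewrite /dot mxE; apply: eq_bigr => i _; rewrite mxE. Qed.

Lemma quadratic_poly_qform n (s : 'F_2) (a : cube n) (M : 'M['F_2]_n) :
  quadratic_poly_fun (fun x => s + dot a x + qform M x).
Proof.
exists s, (fun i => a ord0 i), (fun i j => M i j) => x.
rewrite -dotE; congr (_ + _); rewrite /qform dotE exchange_big /=.
apply: eq_bigr => j _; rewrite mxE mulr_suml; apply: eq_bigr => i _.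
by rewrite [x _ _ * M _ _]mulrC.
Qed.

(** A large squared coefficient of the twisted function gives the linear part, and the constant [s]
    fixes its sign. The trivial bound [vol n] on the coefficient keeps the density [eta] without a
    separate square root. *)
Lemma quadratic_correlation n (f : cube n -> RR) (M : 'M['F_2]_n) (b : cube n)
    (eta : RR) : pm1_valued f ->
    eta * vol n <= \sum_u amb f u (b + u *m (M + M^T)) ->
  exists P, quadratic_poly_fun P /\ eta * vol n <= \sum_x f x * sign_of (P x).
Proof.
move=> hf; under eq_bigr => u _ do rewrite amb_quadratic_twist.
pose g x := f x * sign_of (qform M x).
rewrite -/g => big_eta; have v0 := vol_gt0 n.
have hg : pm1_valued g by move=> x; apply: pm1M => //; apply: sign_of_pm1.
have [a ha] := sum_amb_le_ft b hg.
have corrE (s : 'F_2) :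
    \sum_x f x * sign_of (s + dot a x + qform M x) = sign_of s * ft g a.
  rewrite /ft mulr_sumr; apply: eq_bigr => x _.
  rewrite !sign_ofD -/(chi a x) /g; ring.
have ftE : ft g a = \sum_x f x * sign_of (0 + dot a x + qform M x).
  by rewrite corrE {1}/sign_of eqxx mul1r.
have ft_le (s : 'F_2) : sign_of s * ft g a <= vol n.
  rewrite -corrE /vol -sumr_const; apply: ler_sum => x _.
  by case: (hf x) (sign_of_pm1 (s + dot a x + qform M x)) => -> [] ->; lra.
have [s hs] : exists s, sign_of s * ft g a = `|ft g a|.
  have [h|h] := lerP 0 (ft g a); [exists 0|exists 1].
    by rewrite /sign_of eqxx mul1r ger0_norm.
  by rewrite /sign_of /= mulN1r ltr0_norm.
exists (fun x => s + dot a x + qform M x); split; first exact: quadratic_poly_qform.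
rewrite corrE -(ler_pM2r v0); have := ft_le s; rewrite hs => le_v.
apply: le_trans (_ : `|ft g a| ^+ 2 <= _).
  rewrite real_normK ?num_real //; apply: le_trans ha.
  by rewrite mulrC ler_pM2l.
by rewrite expr2 ler_wpM2l.
Qed.

Lemma fdistE n (f g : cube n -> RR) : pm1_valued f -> pm1_valued g ->
  fdist f g = 2^-1 - (\sum_x f x * g x) / (2 * vol n).
Proof.
move=> hf hg; have v_neq0 : vol n != 0 by rewrite gt_eqF ?vol_gt0.
have -> : \sum_x f x * g x = vol n - 2 * #|[set x : cube n | f x != g x]|%:R.
  rewrite natr_card mulr_sumr /vol -sumr_const -sumrB; apply: eq_bigr => x _.
  rewrite inE; case: (hf x) (hg x) => -> [] ->; case: eqP => /= h; lra.
by rewrite /fdist -/(vol n); field.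
Qed.

(** Some translate of [W] sees at least the average [eta] along [T]. On it [T] differs from
    [M + M^T] by a constant absorbed into [b'], and the rest is dropped by positivity. The density
    is [eta * (eta ^ 2 / 2)], halved again when correlation becomes distance. *)
Lemma quadratic_of_linear n (f : cube n -> RR) (T : 'M['F_2]_n) (b : cube n)
    (eta : RR) : pm1_valued f -> 0 <= eta ->
    eta * vol n <= \sum_y amb f y (y *m T + b) ->
  exists g : cube n -> RR,
    quadratic_polynomial_function g /\ fdist f g <= 2^-1 - eta ^+ 3 / 4.
Proof.
move=> hf eta0 hT; have v0 := vol_gt0 n.
have e3 (x : RR) : eta ^+ 3 / 2 * x = eta * (eta ^+ 2 / 2 * x).
  by clear; field.
have kerbig := symmetry_argument hf eta0 hT.
have [M [W [kerW WT]]] := alternating_extension T.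
have Wbig : eta ^+ 2 / 2 * vol n <= #|W|%:R.
  have : #|[set w : cube n | w *m (T + T^T) == 0]|%:R <= 2 * #|W|%:R :> RR.
    by rewrite -natrM ler_nat.
  move: kerbig; lra.
have [y0 hy0] : exists y0, eta * #|W|%:R <=
    \sum_(w in W) amb f (w + y0) ((w + y0) *m T + b).
  apply: exists_ge_mean; rewrite exchange_big /=.
  apply: le_trans (_ : \sum_(w in W) eta * vol n <= _).
    by rewrite sumr_const -[leRHS]mulr_natr mulrAC.
  apply: ler_sum => w _; apply: le_trans hT _.
  rewrite -[leLHS](sum_shift (fun y => amb f y (y *m T + b)) w).
  by apply: ler_sum => y _; rewrite [y + w]addrC.
pose A := M + M^T; pose b' := y0 *m T + b + y0 *m A.
have [P [quadP corrP]] : exists P, quadratic_poly_fun P /\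
    eta ^+ 3 / 2 * vol n <= \sum_x f x * sign_of (P x).
  apply: (@quadratic_correlation n f M b' _ hf); rewrite -/A.
  rewrite -[leRHS](sum_shift (fun u => amb f u (b' + u *m A)) y0).
  apply: le_trans (_ : eta * #|W|%:R <= _).
    by rewrite e3; apply: ler_wpM2l.
  apply: le_trans hy0 _; rewrite [leLHS]big_mkcond /=; apply: ler_sum => w _.
  case: ifP => [wW|_]; last exact: amb_ge0.
  have -> : b' + (w + y0) *m A = (w + y0) *m T + b; last by [].
  rewrite /b' !mulmxDl (WT w wW) [w *m T + y0 *m A]addrC addrA cube_addrK.
  by rewrite addrC addrA.
exists (fun x => sign_of (P x)); split; first by exists P.
rewrite fdistE //; last by move=> x; apply: sign_of_pm1.
move: corrP; move: (\sum_x _) => s; clear -v0 => hs.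
by rewrite lerD2l lerN2 ler_pdivlMr ?mulr_gt0 //; move: hs; lra.
Qed.

Lemma inverse_u3 n (f : cube n -> RR) (rho : RR) :
    pm1_valued f -> 0 < rho -> 2 * rho <= gowers_norm 3 f ^+ 8 ->
  let K := 2 ^+ 23 / rho ^+ 24 in
  exists (d : nat) (g : cube n -> RR),
    [/\ d%:R <= K ^+ 3, quadratic_polynomial_function g &
        fdist f g <= 2^-1 - (rho ^+ 5 / (4 * K * 2 ^+ d)) ^+ 3 / 4].
Proof.
move=> hf rho0 big_norm K.
have [] := @linear_structure n f rho hf rho0.
  by rewrite -ler_pdivlMr ?vol_gt0 // -gowers3_pow.
move=> T [b [d [dK hT]]].
have [|g [quadg dfg]] := quadratic_of_linear hf _ hT; last by exists d, g.
have K_gt0 : 0 < K by rewrite divr_gt0 ?exprn_gt0.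
apply: divr_ge0; first exact/exprn_ge0/ltW.
by apply: mulr_ge0; [apply: mulr_ge0; last exact: ltW|apply: exprn_ge0].
Qed.

(** With [x = t ^ m], [a * x <= a ^ 2 + x ^ 2], and [x ^ 2 <= t ^ (2 m + 1)]. The extra 1 keeps [C]
    positive when [m = 0]. *)
Lemma exp_absorb (R : realType) (m : nat) (a : R) : 0 <= a ->
  exists C c : R, [/\ 0 < C, 0 < c &
    forall t, 1 <= t -> c * expR (- powR t C) <= expR (- (a * t ^+ m))].
Proof.
move=> a0; exists (m + m).+1%:R, (expR (- a ^+ 2)); split=> [||t t1].
- by rewrite ltr0n.
- exact: expR_gt0.
have t0 : 0 <= t by apply: le_trans t1.
rewrite -exp.expRD ler_expR powR_mulrn //.
have h1 : t ^+ (m + m) <= t ^+ (m + m).+1 by rewrite ler_weXn2l.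
move: h1; rewrite exprD; have := sqr_ge0 (t ^+ m - a).
have := mulr_ge0 a0 (exprn_ge0 m t0).
move: (t ^+ m) (t ^+ (m + m).+1) => x y; nra.
Qed.

Lemma exprn_le_exp (R : realType) (x : R) (k : nat) :
  0 <= x -> (1 + x) ^+ k <= expR (k%:R * x).
Proof.
move=> x0; rewrite expRM_natl lerXn2r ?nnegrE ?expR_ge0 ?addr_ge0 //.
exact: expR_ge1Dx.
Qed.

(** Here [L] is [rho^-1]. The exponent 72 is dictated by [d], which may be as large as
    [2 ^ 69 * L ^ 72]; the other factors are bounded crudely at the same scale. *)
Lemma structure_constant_le_exp (R : realType) (L : R) (d : nat) : 1 <= L ->
    d%:R <= (2 ^+ 23 * L ^+ 24) ^+ 3 ->
  2 ^+ 77 * L ^+ 87 * (2 ^+ d) ^+ 3 <= expR ((77 + 87 + 3 * 2 ^+ 69) * L ^+ 72).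
Proof.
move=> L1 dL; have L0 : 0 <= L by apply: le_trans L1.
have pow2 k : 2 ^+ k <= expR k%:R :> R.
  by have := exprn_le_exp k (@ler01 R); rewrite mulr1.
have L72 : 1 <= L ^+ 72 by rewrite exprn_ege1.
have powL : L ^+ 87 <= expR (87 * L ^+ 72).
  apply: le_trans (_ : (1 + L) ^+ 87 <= _).
    by rewrite lerXn2r ?nnegrE ?addr_ge0 // lerDr.
  apply: le_trans (exprn_le_exp _ L0) _.
  by rewrite ler_expR ler_pM2l // -{1}[L]expr1 ler_weXn2l.
have powd : (2 ^+ d) ^+ 3 <= expR (3 * 2 ^+ 69 * L ^+ 72).
  rewrite -exprM; apply: le_trans (pow2 _) _; rewrite ler_expR mulnC natrM.
  rewrite -mulrA ler_pM2l //; apply: le_trans dL _.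
  by rewrite exprMn -!exprM.
have pow77 : 2 ^+ 77 <= expR (77 * L ^+ 72) :> R.
  by apply: le_trans (pow2 77) _; rewrite ler_expR ler_peMr.
rewrite (mulrDl (77 + 87)) (mulrDl 77 87).
rewrite (exp.expRD (77 * _ + _)) (exp.expRD (77 * _)).
apply: ler_pM => //; last by apply: ler_pM => //; apply: exprn_ge0.
  by apply: mulr_ge0; apply: exprn_ge0.
Qed.

Lemma structure_constantE (F : numFieldType) (rho D : F) : rho != 0 -> D != 0 ->
  (rho ^+ 5 / (4 * (2 ^+ 23 / rho ^+ 24) * D)) ^+ 3 / 4 =
  (2 ^+ 77 * rho^-1 ^+ 87 * D ^+ 3)^-1.
Proof. by move=> rho0 D0; field; rewrite rho0 D0. Qed.

Theorem theorem2p3 :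
  exists C c : RR, 0 < C /\ 0 < c /\
    forall (n : nat) (eps : RR) (f : cube n -> RR),
      (1 <= n)%N -> 0 < eps -> eps <= 1 ->
      pm1_valued f ->
      eps <= gowers_norm 3 f ->
      exists g : cube n -> RR,
        quadratic_polynomial_function g /\
        exists eps' : RR,
          fdist f g <= 2^-1 - eps' /\
          c * expR (- powR (eps^-1) C) <= eps'.
Proof.
(* With [rho = eps ^ 8 / 2], [rho^-1 ^ 72] is [2 ^ 72 * eps^-1 ^ 576], which gives [a] and the
   exponent 576. *)
pose a : RR := (77 + 87 + 3 * 2 ^+ 69) * 2 ^+ 72.
have a0 : 0 <= a by rewrite /a; apply: mulr_ge0 => //; do !apply: addr_ge0 => //; apply: mulr_ge0.
have [C [c [C0 c0 absorb]]] := exp_absorb 576 a0.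
exists C, c; split=> //; split=> // n eps f _ eps0 eps1 hf big_norm.
pose rho := eps ^+ 8 / 2.
have rho0 : 0 < rho by rewrite divr_gt0 ?exprn_gt0.
have [|d [g [dK quadg dfg]]] := inverse_u3 hf rho0.
  rewrite /rho mulrC divfK ?pnatr_eq0 // lerXn2r ?nnegrE ?(ltW eps0) //.
  exact: le_trans (ltW eps0) big_norm.
exists g; split=> //; eexists; split; first exact: dfg.
have t1 : 1 <= eps^-1 by rewrite invf_ge1.
apply: le_trans (absorb _ t1) _.
have rho_neq0 : rho != 0 by rewrite gt_eqF.
have L1 : 1 <= rho^-1.
  rewrite invf_ge1 // /rho ler_pdivrMr // mul1r.
  by apply: le_trans (_ : 1 <= _); rewrite ?exprn_ile1 ?ler1n // ltW.
have dL : d%:R <= (2 ^+ 23 * rho^-1 ^+ 24) ^+ 3 by rewrite exprVn.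
have := structure_constant_le_exp L1 dL.
have -> : (77 + 87 + 3 * 2 ^+ 69) * rho^-1 ^+ 72 = a * eps^-1 ^+ 576.
  rewrite /rho invfM invrK exprMn -exprVn -exprM /a -mulrA.
  by congr (_ * _); rewrite mulrC.
move=> bound; rewrite expRN.
rewrite structure_constantE ?expf_neq0 ?pnatr_eq0 //.
rewrite lef_pV2 ?posrE ?expR_gt0 //.
by rewrite !mulr_gt0 ?exprn_gt0 ?invr_gt0.
Qed.
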